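(* Let $I$ be an ideal of a numerical semigroup $S$, let $n\ge 0$ be an integer, and let $R(I)=\{r\in \mathbb{Z}[X_1,\dots,X_n]: r(s_1,\dots,s_n)\geq 0\ \text{ for all } s_1\geq\cdots\geq s_n \text{ in } I\}$. Then $R(I)$ is a semiring with zero and unit elements, and $\mathcal{P}_n(I)$ is an $R(I)$-semialgebra (with respect to addition and multiplication of polynomials).
   Context: $\mathbb{Z}_+$ denotes the set of non-negative integers. A numerical semigroup is a subset of $\mathbb{Z}_+$ that contains $0$, is closed under addition and has finite complement in $\mathbb{Z}_+$. An ideal of a numerical semigroup $S$ is a nonempty subset $I\subseteq S$ with $I+S\subseteq I$. A pattern admitted by the ideal $I$ of $S$ is a polynomial $p(X_1,\dots,X_n)$ with integer coefficients such that $p(s_1,\dots,s_n)\in S$ for every non-increasing sequence $s_1\ge\cdots\ge s_n$ of elements of $I$; its length is the number of indeterminates. $\mathcal{P}_n(I)$ denotes the set of patterns of length at most $n$ (and arbitrary degree) admitted by $I$, regarded as polynomials in $\mathbb{Z}[X_1,\dots,X_n]$. A semiring is a set with two binary operations, addition and multiplication, that is a semigroup under each of them and in which multiplication distributes over addition; a zero or unit element is not required in general. If $\Sigma$ is a (commutative) semiring with unit, a semiring $X$ is a $\Sigma$-semialgebra if there is a map $\Sigma\times X\to X$, $(\sigma,x)\mapsto\sigma x$, such that $\sigma(x+y)=\sigma x+\sigma y$, $(\sigma+\rho)x=\sigma x+\rho x$, $(\sigma\rho)x=\sigma(\rho x)$, $1\cdot x=x$ (that is, $(X,+)$ is a $\Sigma$-semimodule)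 and $\sigma(xy)=(\sigma x)y=x(\sigma y)$ for all $\sigma,\rho\in\Sigma$ and $x,y\in X$. Here the action of $R(I)$ on $\mathcal{P}_n(I)$ is multiplication of polynomials. *)

(* Defs.v *)
From mathcomp Require Import all_boot all_order all_algebra.
From mathcomp Require Import mpoly.
From mathcomp Require Import boolp classical_sets cardinality.

Set Implicit Arguments.
Unset Strict Implicit.
Unset Printing Implicit Defensive.

Import GRing.Theory Num.Theory.

Local Open Scope classical_set_scope.
Local Open Scope ring_scope.

Record numerical_semigroup (S : set nat) : Prop := {
  numsg0 : S 0%N;
  numsgD : forall x y, S x -> S y -> S (x + y)%N;
  numsg_cofinite : finite_set (~` S)
}.

Record numsg_ideal (S I : set nat) : Prop := {
  ideal_neq0 : I !=set0;
  ideal_sub : I `<=` S;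
  idealD : forall x s, I x -> S s -> I (x + s)%N
}.

Definition nonincreasing_in (I : set nat) (n : nat) (s : 'I_n -> nat) : Prop :=
  (forall i, I (s i)) /\ (forall i j : 'I_n, (i <= j)%N -> (s j <= s i)%N).

Definition eval_nat (n : nat) (p : {mpoly int[n]}) (s : 'I_n -> nat) : int :=
  p.@[fun i => (s i)%:Z].

Definition admits (S I : set nat) (n : nat) (p : {mpoly int[n]}) : Prop :=
  forall s : 'I_n -> nat, nonincreasing_in I s -> (Posz @` S) (eval_nat p s).

Definition widen_mpoly (m n : nat) (le_mn : (m <= n)%N) (q : {mpoly int[m]}) :
    {mpoly int[n]} :=
  q \mPo [tuple 'X_(widen_ord le_mn i) | i < m].

(* The patterns of length m <= n, each regarded in Z[X_1, ..., X_n]. *)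
Definition patterns (S I : set nat) (n : nat) : set {mpoly int[n]} :=
  [set p | exists (m : nat) (le_mn : (m <= n)%N) (q : {mpoly int[m]}),
             admits S I q /\ p = widen_mpoly le_mn q].
Arguments patterns S I n : clear implicits.

Definition nonneg_polys (I : set nat) (n : nat) : set {mpoly int[n]} :=
  [set r | forall s : 'I_n -> nat, nonincreasing_in I s -> 0 <= eval_nat r s].
Arguments nonneg_polys I n : clear implicits.

(* The structures below live on a subset A of an ambient type, with operations
   of the ambient type restricted to A; closure of A is part of the axioms. *)

Record semigroup_on (T : Type) (A : set T) (op : T -> T -> T) : Prop := {
  sg_closed : forall x y, A x -> A y -> A (op x y);
  sg_assoc : forall x y z, A x -> A y -> A z ->
    op x (op y z) = op (op x y) z
}.

(* Neither a zero nor a unit is required. *)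
Record semiring_on (T : Type) (A : set T) (add mul : T -> T -> T) : Prop := {
  sr_add : semigroup_on A add;
  sr_mul : semigroup_on A mul;
  sr_distl : forall x y z, A x -> A y -> A z ->
    mul (add x y) z = add (mul x z) (mul y z);
  sr_distr : forall x y z, A x -> A y -> A z ->
    mul x (add y z) = add (mul x y) (mul x z)
}.

Record zero_element_on (T : Type) (A : set T) (add mul : T -> T -> T)
    (zero : T) : Prop := {
  zero_in : A zero;
  zero_addl : forall x, A x -> add zero x = x;
  zero_addr : forall x, A x -> add x zero = x;
  zero_mull : forall x, A x -> mul zero x = zero;
  zero_mulr : forall x, A x -> mul x zero = zero
}.

Record unit_element_on (T : Type) (A : set T) (mul : T -> T -> T)
    (one : T) : Prop := {
  unit_in : A one;
  unit_mull : forall x, A x -> mul one x = x;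
  unit_mulr : forall x, A x -> mul x one = x
}.

(* X is a semialgebra over Sg, a commutative semiring with unit [one]. *)
Record semialgebra_on
    (T : Type) (Sg : set T) (addS mulS : T -> T -> T) (one : T)
    (U : Type) (X : set U) (add mul : U -> U -> U)
    (act : T -> U -> U) : Prop := {
  sa_scalars : semiring_on Sg addS mulS;
  sa_scalars_comm : forall a b, Sg a -> Sg b -> mulS a b = mulS b a;
  sa_scalars_unit : unit_element_on Sg mulS one;
  sa_semiring : semiring_on X add mul;
  sa_act_closed : forall a x, Sg a -> X x -> X (act a x);
  sa_actDr : forall a x y, Sg a -> X x -> X y ->
    act a (add x y) = add (act a x) (act a y);
  sa_actDl : forall a b x, Sg a -> Sg b -> X x ->
    act (addS a b) x = add (act a x) (act b x);
  sa_actA : forall a b x, Sg a -> Sg b -> X x ->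
    act (mulS a b) x = act a (act b x);
  sa_act1 : forall x, X x -> act one x = x;
  sa_actMl : forall a x y, Sg a -> X x -> X y ->
    act a (mul x y) = mul (act a x) y;
  sa_actMr : forall a x y, Sg a -> X x -> X y ->
    act a (mul x y) = mul x (act a y)
}.

(* Main.v *)
Require Import Defs.
From mathcomp Require Import all_boot all_order all_algebra.
From mathcomp Require Import mpoly.
From mathcomp Require Import boolp classical_sets cardinality.

(** Everything is decided by values: evaluation at a point is a ring morphism,
    so closure of R(I) is closure of the non-negative integers under sum and
    product, and the algebraic identities are those of the polynomial ring.

    Two facts make this work for the patterns.  A pattern of length m <= n,
    read in n variables, takes at a non-increasing sequence the value of the
    original one at the initial segment of that sequence, which is again
    non-increasing; so the patterns of length at most n are exactly the
    polynomials in n variables that are admitted ([patternsE]).  And S absorbs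
    every natural factor, a multiple k * s being a repeated sum of s
    ([numsg_mull]); this gives both the product of two patterns and the action
    of R(I), whose elements take at non-increasing sequences in I values that
    are natural numbers but need not lie in S. *)

Import GRing.Theory Num.Theory.
Local Open Scope classical_set_scope.
Local Open Scope ring_scope.

Lemma numsg_mull (S : set nat) (k x : nat) :
  numerical_semigroup S -> S x -> S (k * x)%N.
Proof.
move=> hS Sx; elim: k => [|k IHk]; first by rewrite mul0n; exact: numsg0.
by rewrite mulSn; apply: numsgD.
Qed.

Lemma eval_widen_mpoly (m n : nat) (le_mn : (m <= n)%N) (q : {mpoly int[m]})
    (s : 'I_n -> nat) :
  eval_nat (widen_mpoly le_mn q) s = eval_nat q (s \o widen_ord le_mn).
Proof.
rewrite /eval_nat /widen_mpoly comp_mpoly_meval.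
by apply: meval_eq => i; rewrite tnth_mktuple mevalXU.
Qed.

Lemma widen_mpoly_id (n : nat) (p : {mpoly int[n]}) :
  widen_mpoly (leqnn n) p = p.
Proof.
(* The monomial of a variable depends on its index only through its value, so
   the substitution is convertible to the identity one. *)
exact: comp_mpoly_id.
Qed.

(** Restricting a non-increasing sequence to its first m terms keeps it
    non-increasing, so the passage to more variables preserves admission. *)
Lemma patternsE (S I : set nat) (n : nat) (p : {mpoly int[n]}) :
  patterns S I n p <-> admits S I p.
Proof.
split=> [[m [le_mn [q [admq ->]]]] s [Is s_noninc]|admp].
  by rewrite eval_widen_mpoly; apply: admq; split=> [i|i j le_ij] /=; auto.
by exists n, (leqnn n), p; rewrite widen_mpoly_id.
Qed.

Lemma eval_natD (n : nat) (p q : {mpoly int[n]}) (s : 'I_n -> nat) :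
  eval_nat (p + q) s = eval_nat p s + eval_nat q s.
Proof. exact: mevalD. Qed.

Lemma eval_natM (n : nat) (p q : {mpoly int[n]}) (s : 'I_n -> nat) :
  eval_nat (p * q) s = eval_nat p s * eval_nat q s.
Proof. exact: mevalM. Qed.

Lemma nonneg_polys_semiring (I : set nat) (n : nat) :
  semiring_on (nonneg_polys I n) +%R *%R.
Proof.
split; [split | split | |] => p q *; try by rewrite (addrA, mulrA, mulrDl, mulrDr).
- by move=> s sI; rewrite eval_natD addr_ge0; auto.
- by move=> s sI; rewrite eval_natM mulr_ge0; auto.
Qed.

Lemma nonneg_polys_zero (I : set nat) (n : nat) :
  zero_element_on (nonneg_polys I n) +%R *%R 0.
Proof.
split=> [s _|p _|p _|p _|p _]; rewrite ?(add0r, addr0, mul0r, mulr0) //.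
by rewrite /eval_nat meval0.
Qed.

Lemma nonneg_polys_unit (I : set nat) (n : nat) :
  unit_element_on (nonneg_polys I n) *%R 1.
Proof.
split=> [s _|p _|p _]; rewrite ?(mul1r, mulr1) //.
by rewrite /eval_nat meval1.
Qed.

Lemma admitsD (S I : set nat) (n : nat) (p q : {mpoly int[n]}) :
  numerical_semigroup S -> admits S I p -> admits S I q -> admits S I (p + q).
Proof.
move=> hS admp admq s sI; rewrite eval_natD.
have [x Sx <-] := admp s sI; have [y Sy <-] := admq s sI.
by exists (x + y)%N => //; apply: numsgD.
Qed.

(** The value of a polynomial in R(I) is a natural number, and S absorbs
    natural factors. *)
Lemma admits_nonneg_mull (S I : set nat) (n : nat) (r p : {mpoly int[n]}) :
  numerical_semigroup S -> nonneg_polys I n r -> admits S I p ->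
  admits S I (r * p).
Proof.
move=> hS rge0 admp s sI; rewrite eval_natM.
have [x Sx <-] := admp s sI.
exists (`|eval_nat r s| * x)%N; first exact: numsg_mull.
by rewrite PoszM gez0_abs //; apply: rge0.
Qed.

(** Being contained in the naturals, S only takes non-negative values, so the
    product of two patterns is a special case of the action of R(I). *)
Lemma admits_nonneg (S I : set nat) (n : nat) (p : {mpoly int[n]}) :
  admits S I p -> nonneg_polys I n p.
Proof. by move=> admp s sI; have [x _ <-] := admp s sI. Qed.

Lemma patterns_semiring (S I : set nat) (n : nat) :
  numerical_semigroup S -> semiring_on (patterns S I n) +%R *%R.
Proof.
move=> hS.
split; [split | split | |] => p q *; try by rewrite (addrA, mulrA, mulrDl, mulrDr).
- by apply/patternsE; apply: admitsD => //; apply/patternsE.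
- apply/patternsE; apply: admits_nonneg_mull => //; last exact/patternsE.
  by apply: (admits_nonneg S); apply/patternsE.
Qed.

Theorem lemma30 (S I : set nat) (hS : numerical_semigroup S)
    (hI : numsg_ideal S I) (n : nat) :
  let add (p q : {mpoly int[n]}) : {mpoly int[n]} := (p + q)%R in
  let mul (p q : {mpoly int[n]}) : {mpoly int[n]} := (p * q)%R in
  [/\ semiring_on (nonneg_polys I n) add mul,
      zero_element_on (nonneg_polys I n) add mul 0%R,
      unit_element_on (nonneg_polys I n) mul 1%R &
      semialgebra_on (nonneg_polys I n) add mul 1%R
                     (patterns S I n) add mul mul].
Proof.
move=> add mul; rewrite /add /mul.
have Rsemiring := nonneg_polys_semiring I n.
have Runit := nonneg_polys_unit I n.
split=> //; first exact: nonneg_polys_zero.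
split=> //.
- by move=> a b _ _; rewrite mulrC.
- exact: patterns_semiring.
- by move=> a x Ra /patternsE admx; apply/patternsE; apply: admits_nonneg_mull.
- by move=> a x y _ _ _; rewrite mulrDr.
- by move=> a b x _ _ _; rewrite mulrDl.
- by move=> a b x _ _ _; rewrite mulrA.
- by move=> x _; rewrite mul1r.
- by move=> a x y _ _ _; rewrite mulrA.
- by move=> a x y _ _ _; rewrite mulrCA.
Qed.
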